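(* Let $m\ge2$ and $1\le k\le 3$, and let $p_{8k}(n)$, $\mu=\mu_m(k)$ and $c_1$ be as defined in the context. The following hold: (i) If $c_1^\alpha\not\equiv0\pmod m$ for every $\alpha\ge1$, then for all $\alpha\ge 1$ and $n\ge0$, $$p_{8k}\left(2^{2\mu\alpha}n+\frac{(2k+3)\cdot2^{2\mu\alpha-1}-k}{3}\right)\equiv0\pmod m.$$ (ii) If $\alpha$ is a positive integer such that $c_1^\alpha\equiv0\pmod m$, then for all $n\ge0$, $$p_{8k}\left(2^{2\mu\alpha-1}n+\frac{k(2^{2\mu\alpha}-1)}{3}\right)\equiv0\pmod m.$$
   Context: The integers $p_j(n)$ are defined by $\prod_{n\ge1}(1-q^n)^j=\sum_{n\ge0}p_j(n)q^n$. The integer sequences $A_k(\alpha),B_k(\alpha)$ ($1\le k\le3$, $\alpha\ge0$) are defined as follows: for each $k$ both satisfy $s(\alpha+4)=f(k)s(\alpha+2)+g(k)s(\alpha)$ for $\alpha\ge0$, where $f(1)=-8,\ g(1)=0$; $f(2)=104,\ g(2)=-2^{14}$; $f(3)=-3520,\ g(3)=-2^{22}$, with initial values $(s(0),s(1),s(2),s(3))$: $A_1:(1,-8,-8,64)$, $B_1:(0,0,0,0)$; $A_2:(1,128,104,-3072)$, $B_2:(0,1,-2048,104)$; $A_3:(1,-2048,-1472,3014656)$, $B_3:(0,-24,49152,84480)$. For $m\ge2$, $\mu_m(k)=\min\{\alpha\ge1 : B_k(2\alpha-1)\equiv0\pmod m\}$ (this minimum is known to exist for every $m\ge 2$), and $c_1$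 is the integer with $0\le c_1\le m-1$ and $c_1\equiv A_k(2\mu_m(k)-1)\pmod m$. *)

(* Defs.v *)
From HB Require Import structures.
From mathcomp Require Import all_boot all_order all_algebra.
From mathcomp Require Import ring zify.

Set Implicit Arguments.
Unset Strict Implicit.
Unset Printing Implicit Defensive.

Import Order.TTheory GRing.Theory Num.Theory.
Local Open Scope ring_scope.

(* The coefficient of q^n in the infinite product of the (1 - q^i)^j, i >= 1,
   is that of the partial product over 1 <= i <= n, since the factors with
   i > n are 1 modulo q^(n+1); see [pcoef_stable]. *)
Definition pcoef (j n : nat) : int :=
  (\prod_(1 <= i < n.+1) (1 - 'X^i) ^+ j : {poly int})`_n.

Lemma pcoef_stable (j n N : nat) : (n <= N)%N ->
  (\prod_(1 <= i < N.+1) (1 - 'X^i) ^+ j : {poly int})`_n = pcoef j n.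
Proof.
elim: N => [|N IH] leN; first by move: leN; rewrite leqn0 => /eqP->.
case: (eqVneq n N.+1) => [->//|neN].
have ltN : (n < N.+1)%N by rewrite ltn_neqAle neN.
rewrite big_nat_recr //= -IH //.
set P : {poly int} := \prod_(1 <= i < N.+1) _.
have [Q ->] : exists Q : {poly int}, (1 - 'X^(N.+1)) ^+ j = 1 + Q * 'X^(N.+1).
  elim: j {P IH} => [|j [Q IHj]]; first by exists 0; rewrite expr0 mul0r addr0.
  exists (Q - 1 - Q * 'X^(N.+1)); rewrite exprS IHj; ring.
by rewrite mulrDr mulr1 coefD mulrA coefMXn ltN addr0.
Qed.

Fixpoint recseq (f g s0 s1 s2 s3 : int) (a : nat) : int :=
  match a with
  | 0 => s0
  | 1 => s1
  | 2 => s2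
  | 3 => s3
  | (((a0.+2) as a2).+2) =>
      f * recseq f g s0 s1 s2 s3 a2 + g * recseq f g s0 s1 s2 s3 a0
  end.

(* Junk value 0 outside 1 <= k <= 3. *)
Definition fcoef (k : nat) : int :=
  match k with 1 => -8 | 2 => 104 | 3 => -3520 | _ => 0 end.

Definition gcoef (k : nat) : int :=
  match k with 1 => 0 | 2 => - (2 ^+ 14) | 3 => - (2 ^+ 22) | _ => 0 end.

(* The large initial values are factored because numerals are unary here:
   23 * 2^17 = 3014656, 3 * 2^14 = 49152 and 165 * 2^9 = 84480. *)
Definition A (k a : nat) : int :=
  match k with
  | 1 => recseq (fcoef 1) (gcoef 1) 1 (-8) (-8) 64 a
  | 2 => recseq (fcoef 2) (gcoef 2) 1 128 104 (-3072) a
  | 3 => recseq (fcoef 3) (gcoef 3) 1 (-2048) (-1472) (23 * 2 ^+ 17) a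
  | _ => 0
  end.

Definition B (k a : nat) : int :=
  match k with
  | 1 => recseq (fcoef 1) (gcoef 1) 0 0 0 0 a
  | 2 => recseq (fcoef 2) (gcoef 2) 0 1 (-2048) 104 a
  | 3 => recseq (fcoef 3) (gcoef 3) 0 (-24) (3 * 2 ^+ 14) (165 * 2 ^+ 9) a
  | _ => 0
  end.

(* [is_mu m k mu] : mu is the least a >= 1 with m | B k (2 a - 1).  Such a mu
   exists and is unique, see [is_mu_exists] and [is_mu_unique]. *)
Definition is_mu (m k mu : nat) : Prop :=
  [/\ (1 <= mu)%N, (m%:Z %| B k (2 * mu - 1))%Z &
      forall a : nat, (1 <= a)%N -> (m%:Z %| B k (2 * a - 1))%Z -> (mu <= a)%N].

Lemma is_mu_unique (m k mu nu : nat) : is_mu m k mu -> is_mu m k nu -> mu = nu.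
Proof.
move=> [mu1 mB muP] [nu1 nB nuP].
by apply/eqP; rewrite eqn_leq muP // nuP.
Qed.

Section Existence.

Variables (f g : int) (r : nat) (u : nat -> int).
Hypothesis f_even : (2 %| f)%Z.
Hypothesis gE : g = - (2 ^+ r.+2).
Hypothesis u0 : u 0 = 0.
Hypothesis uSS : forall i, u i.+2 = f * u i.+1 + g * u i.

Let dvd_pow2 i : (2 ^+ i %| u i.+1)%Z /\ (2 ^+ i %| 2 * u i)%Z.
Proof.
elim: i => [|i [IH1 IH2]]; first by rewrite expr0 !dvd1z.
split; last by rewrite exprS dvdz_mul.
rewrite uSS; apply: rpredD; first by rewrite exprS dvdz_mul.
have -> : g * u i = - (2 ^+ r) * (2 * (2 * u i)) by rewrite gE !exprS; ring.
by rewrite dvdz_mull // exprS dvdz_mul.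
Qed.

Let dvd_pow2_ge s i : (s < i)%N -> (2 ^+ s %| u i)%Z.
Proof.
case: i => // i; rewrite ltnS => les.
by apply: dvdz_trans (dvd_pow2 i).1; rewrite -(subnK les) exprD dvdz_mull.
Qed.

Let odd_period (m : nat) : odd m ->
  exists2 P : nat, (0 < P)%N & forall t, (m%:Z %| u (P * t))%Z.
Proof.
move=> oddm; pose M := (3 * m)%N.
have M_gt1 : (1 < M)%N by have := odd_gt0 oddm; rewrite /M; lia.
pose step (x : 'Z_M * 'Z_M) := (x.2, f%:~R * x.2 + g%:~R * x.1).
have g_unit : (g%:~R : 'Z_M) \is a GRing.unit.
  rewrite gE rmorphN rmorphXn /= unitrN unitrX //.
  by rewrite -[2%:~R]/(2%:R) unitZpE // /M coprimeMl !coprimen2 oddm.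
have step_inj : injective step.
  move=> [a b] [c d] e; have e1 : b = d := congr1 fst e.
  have e2 : f%:~R * b + g%:~R * a = f%:~R * d + g%:~R * c := congr1 snd e.
  rewrite e1 in e2 *.
  by move/addrI/(mulrI g_unit): e2 => ->.
pose x0 : 'Z_M * 'Z_M := ((u 0)%:~R, (u 1)%:~R).
have stepE i : iter i step x0 = ((u i)%:~R, (u i.+1)%:~R).
  by elim: i => //= i ->; rewrite /step /= uSS rmorphD !rmorphM.
exists (order step x0) => [|t]; first exact: order_gt0.
have : iter (order step x0 * t) step x0 = x0.
  elim: t => [|t IH]; first by rewrite muln0.
  by rewrite mulnS iterD IH iter_order.
rewrite stepE => /(congr1 fst) /=; rewrite u0 => uP.
apply: (@dvdz_trans M%:Z); first by rewrite /M PoszM dvdz_mull.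
suff uP' : (`|u (order step x0 * t)|%N%:R : 'Z_M) = 0.
  have /= := congr1 val uP'; rewrite val_Zp_nat // => uM.
  by rewrite dvdzE; apply/eqP.
move: uP; case: (u _) => n //.
by rewrite NegzE rmorphN /= => /eqP; rewrite oppr_eq0 => /eqP.
Qed.

Lemma rec_zero_mod (m : nat) : (0 < m)%N ->
  exists2 a : nat, (0 < a)%N & (m%:Z %| u a)%Z.
Proof.
move=> m_gt0; case: (@pfactor_coprime 2 m isT m_gt0) => m' com' mE.
have oddm' : odd m' by rewrite -coprime2n.
have [P P_gt0 uP] := odd_period oddm'.
set s := logn 2 m in mE.
exists (P * s.+1)%N; first by rewrite muln_gt0 P_gt0.
rewrite mE PoszM Gauss_dvdz ?uP /=; last first.
  by rewrite coprimezE /= coprimeXr // coprime_sym.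
have -> : (2 ^ s)%N%:Z = 2 ^+ s by rewrite -natz natrX.
by apply: dvd_pow2_ge; rewrite leq_pmull.
Qed.

End Existence.

Lemma is_mu_exists (m k : nat) : (2 <= m)%N -> (1 <= k <= 3)%N ->
  exists mu, is_mu m k mu.
Proof.
move=> m2 k13.
have [a a_gt0 aB] : exists2 a, (0 < a)%N & (m%:Z %| B k (2 * a - 1))%Z.
  have m_gt0 : (0 < m)%N by lia.
  pose u k a := if a is a'.+1 then B k (2 * a' + 1) else 0.
  have e a : (2 * a.+1 - 1 = 2 * a + 1)%N by lia.
  have e1 a : (2 * a.+1 + 1 = (2 * a + 1).+2)%N by lia.
  have e2 a : (2 * a + 1 = (2 * a).+1)%N by lia.
  case: k k13 => [|[|[|[|]]]] // _; first by exists 1%N.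
  - have uSS i : u 2 i.+2 = fcoef 2 * u 2 i.+1 + gcoef 2 * u 2 i.
      by case: i => [|i]; rewrite /u ?e1 ?e2 /B.
    have [[|a] // _ ua] := @rec_zero_mod (fcoef 2) _ 12 (u 2) isT erefl erefl uSS _ m_gt0.
    by exists a.+1; rewrite ?e.
  - have uSS i : u 3 i.+2 = fcoef 3 * u 3 i.+1 + gcoef 3 * u 3 i.
      by case: i => [|i]; rewrite /u ?e1 ?e2 /B.
    have [[|a] // _ ua] := @rec_zero_mod (fcoef 3) _ 20 (u 3) isT erefl erefl uSS _ m_gt0.
    by exists a.+1; rewrite ?e.
pose Q a := (1 <= a)%N && (m%:Z %| B k (2 * a - 1))%Z.
have exQ : exists a, Q a by exists a; rewrite /Q a_gt0.
exists (ex_minn exQ); case: ex_minnP => n /andP[n1 nB] nmin.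
by split=> // b b1 bB; apply: nmin; rewrite /Q b1.
Qed.

(* The two index offsets are integers, so the truncated operations of nat
   compute them exactly. *)
Lemma dvd3_offset1 (k t : nat) : (1 <= t)%N ->
  (k <= (2 * k + 3) * 2 ^ (2 * t - 1))%N
  /\ (3 %| (2 * k + 3) * 2 ^ (2 * t - 1) - k)%N.
Proof.
case: t => // t _; have -> : (2 * t.+1 - 1 = (2 * t).+1)%N by lia.
rewrite expnS expnM -[(2 ^ 2)%N]/4%N.
have [q ->] : exists q, (4 ^ t = 3 * q + 1)%N.
  by elim: t => [|t [q IH]]; [exists 0%N | exists (4 * q + 1)%N; rewrite expnS IH; lia].
split; first by nia.
by apply/dvdnP; exists (4 * k * q + 6 * q + k + 2)%N; nia.
Qed.

Lemma dvd3_offset2 (k t : nat) : (3 %| k * (2 ^ (2 * t) - 1))%N.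
Proof.
rewrite expnM -[(2 ^ 2)%N]/4%N.
by elim: t => [|t IH]; [rewrite muln0 | rewrite expnS; nia].
Qed.

(* Main.v *)
(** Write E(q) = prod_(n >= 1) (1 - q^n). Everything rests on Jacobi's identity
    E(q)^8 - E(-q)^8 = -16 q E(q^4)^8. It is obtained from Gauss's product
    phi(-q) = E(q)^2 / E(q^2) for phi(q) = sum_(n in Z) q^(n^2) (through a finite
    identity of Shanks) and the dissection phi(q) = phi(q^4) + 2 q psi(q^8),
    with psi(q) = sum_(n >= 0) q^(n (n + 1) / 2).
    Together with E(q) E(-q) E(q^4) = E(q^2)^3 it gives the two-term and
    three-term recurrences, under multiplication of the index by 2 or 8, of the
    coefficients a(n) of eta(3 z)^(8 k), that is a(3 n + k) = p_(8 k)(n). By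
    induction a(2^(2 j - 1) n) = A_k(2 j - 1) a(n / 2) + B_k(2 j - 1) b(n) with b
    integral, where a(n / 2) = 0 for odd n. At j = mu the second term vanishes
    modulo m; iterating, a(2^(2 mu alpha - 1) n) = c_1^alpha a(n / 2) modulo m.
    Odd n give (i), and c_1^alpha = 0 gives (ii). *)

Require Import Defs.
From mathcomp Require Import all_boot all_order all_algebra.
From HB Require Import structures.
From mathcomp Require Import boolp ring zify.
Import Order.TTheory GRing.Theory Num.Theory.
Local Open Scope ring_scope.

(** * The ring Z[[q]] *)

Definition series : Type := nat -> int.

HB.instance Definition _ := gen_eqMixin series.
HB.instance Definition _ := gen_choiceMixin series.

Definition series_add (f g : series) : series := fun n => f n + g n.
Definition series_opp (f : series) : series := fun n => - f n.
Definition series_zero : series := fun _ => 0.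
Definition series_one : series := fun n => (n == 0%N)%:R.
Definition series_mul (f g : series) : series :=
  fun n => \sum_(i < n.+1) f i * g (n - i)%N.

Lemma series_eqP (f g : series) : f =1 g -> f = g.
Proof. exact: funext. Qed.

Lemma series_addA : associative series_add.
Proof. by move=> f g h; apply: series_eqP => n; apply: addrA. Qed.
Lemma series_addC : commutative series_add.
Proof. by move=> f g; apply: series_eqP => n; apply: addrC. Qed.
Lemma series_add0 : left_id series_zero series_add.
Proof. by move=> f; apply: series_eqP => n; apply: add0r. Qed.
Lemma series_addN : left_inverse series_zero series_opp series_add.
Proof. by move=> f; apply: series_eqP => n; apply: addNr. Qed.

HB.instance Definition _ := GRing.isZmodule.Build series
  series_addA series_addC series_add0 series_addN.

(** Polynomial truncations below degree N transfer identities of [{poly int}], ring laws included,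
    to series through [approx_eq]. *)
Definition approx (N : nat) (f : series) (p : {poly int}) : Prop :=
  forall i, (i < N)%N -> f i = p`_i.

Lemma approx_trunc N f : approx N f (\poly_(i < N) f i).
Proof. by move=> i ltiN; rewrite coef_poly ltiN. Qed.

Lemma approx_mul N f g p r :
  approx N f p -> approx N g r -> approx N (series_mul f g) (p * r).
Proof.
move=> fp gr i ltiN; rewrite coefM; apply: eq_bigr => j _.
by rewrite fp ?gr //; [apply: leq_ltn_trans (leq_subr _ _) ltiN
                      | apply: leq_trans (ltn_ord j) ltiN].
Qed.

Lemma approx_eq f g :
  (forall N, exists2 p, approx N f p & approx N g p) -> f = g.
Proof.
by move=> fg; apply: series_eqP => n; have [p -> // ->] := fg n.+1.
Qed.

Lemma series_mulA : associative series_mul.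
Proof.
move=> f g h; apply: approx_eq => N.
set T := fun f : series => \poly_(i < N) f i.
exists (T f * (T g * T h)); last rewrite mulrA;
  by do ?apply: approx_mul; apply: approx_trunc.
Qed.

Lemma series_mulC : commutative series_mul.
Proof.
move=> f g; apply: approx_eq => N.
set T := fun f : series => \poly_(i < N) f i.
exists (T f * T g); last rewrite mulrC;
  by apply: approx_mul; apply: approx_trunc.
Qed.

Lemma series_mul1 : left_id series_one series_mul.
Proof.
move=> f; apply: series_eqP => n.
rewrite /series_mul big_ord_recl subn0 mul1r big1 ?addr0 // => i _.
by rewrite mul0r.
Qed.

Lemma series_mulDl : left_distributive series_mul series_add.
Proof.
move=> f g h; apply: series_eqP => n.
by rewrite /series_add /series_mul -big_split; apply: eq_bigr => i _; rewrite mulrDl.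
Qed.

Lemma series_one_neq0 : series_one != 0.
Proof. by apply/eqP => /(congr1 (fun f : series => f 0%N)). Qed.

HB.instance Definition _ := GRing.Zmodule_isComNzRing.Build series
  series_mulA series_mulC series_mul1 series_mulDl series_one_neq0.

Lemma coefsD (f g : series) n : (f + g) n = f n + g n. Proof. by []. Qed.
Lemma coefsN (f : series) n : (- f) n = - f n. Proof. by []. Qed.
Lemma coefsB (f g : series) n : (f - g) n = f n - g n. Proof. by []. Qed.
Lemma coefs1 n : (1 : series) n = (n == 0%N)%:R. Proof. by []. Qed.
Lemma coefsM (f g : series) n :
  (f * g) n = \sum_(i < n.+1) f i * g (n - i)%N.
Proof. by []. Qed.

Lemma coefsM0 (f g : series) : (f * g) 0%N = f 0%N * g 0%N.
Proof. by rewrite coefsM big_ord1. Qed.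

Lemma coefsX0 (f : series) k : (f ^+ k) 0%N = f 0%N ^+ k.
Proof. by elim: k => // k IH; rewrite !exprS coefsM0 IH. Qed.

Lemma coefsMn (f : series) k n : (f *+ k) n = f n *+ k.
Proof. by elim: k => // k IH; rewrite !mulrS coefsD IH. Qed.

Lemma coefs_natM k (f : series) n : (k%:R * f) n = k%:R * f n.
Proof. by rewrite !mulr_natl coefsMn. Qed.

Lemma approxM N f g p r :
  approx N f p -> approx N g r -> approx N (f * g) (p * r).
Proof. exact: approx_mul. Qed.

Lemma approx1 N : approx N 1 1.
Proof. by move=> i _; rewrite coef1. Qed.

Lemma approxX N f p k : approx N f p -> approx N (f ^+ k) (p ^+ k).
Proof.
move=> fp; elim: k => [|k IH]; first exact: approx1.
by rewrite !exprS; apply: approxM.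
Qed.

Definition q : series := fun n => (n == 1%N)%:R.

Lemma coefs_qM (f : series) n : (q * f) n = if n is n'.+1 then f n' else 0.
Proof.
rewrite coefsM; case: n => [|n]; first by rewrite big_ord1 mul0r.
rewrite big_ord_recl mul0r add0r big_ord_recl /= mul1r big1 ?addr0 ?subn1 //.
by move=> i _; rewrite mul0r.
Qed.

Lemma coefs_qMS (f : series) n : (q * f) n.+1 = f n.
Proof. by rewrite coefs_qM. Qed.

(** If the coefficients of h below n vanish, then u h has coefficient u(0) h(n) at n; strong
    induction applies, since [int] has no zero divisors. *)
Lemma series_cancel (u f g : series) : u 0%N != 0 -> u * f = u * g -> f = g.
Proof.
move=> u0 /eqP; rewrite -subr_eq0 -mulrBr => /eqP uh; apply/eqP.
rewrite -subr_eq0; apply/eqP; move: (f - g) uh => h uh.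
apply: series_eqP => n; elim/ltn_ind: n => n IH.
have := congr1 (fun f : series => f n) uh.
rewrite coefsM big_ord_recl subn0 big1 ?addr0.
  by move/eqP; rewrite mulf_eq0 (negbTE u0) => /eqP.
by move=> i _; rewrite IH ?mulr0 //= /bump /=; case: n i {IH} => [[]|n i] //; lia.
Qed.

Lemma q_cancel (f g : series) : q * f = q * g -> f = g.
Proof.
move=> e; apply: series_eqP => n.
by have := congr1 (fun f : series => f n.+1) e; rewrite !coefs_qM.
Qed.

(** * The substitutions q -> q^2 ([dil]) and q -> -q ([alt]) *)

Definition dil (f : series) : series :=
  fun n => if (2 %| n)%N then f (n %/ 2)%N else 0.

Definition alt (f : series) : series := fun n => (-1) ^+ n * f n.

Lemma dil_even f n : dil f (2 * n)%N = f n.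
Proof. by rewrite /dil dvdn_mulr // mulKn. Qed.

Lemma approx_dil N f p : approx N f p -> approx N (dil f) (p \Po 'X^2).
Proof.
move=> fp i ltiN; rewrite coef_comp_poly_Xn // /dil.
by case: ifP => // _; apply: fp; apply: leq_ltn_trans (leq_div _ _) ltiN.
Qed.

Lemma approx_alt N f p : approx N f p -> approx N (alt f) (p \Po (- 'X)).
Proof.
move=> fp i ltiN; rewrite /alt fp // coef_comp_poly.
have coefNX j : ((- 'X) ^+ j : {poly int})`_i = (-1) ^+ j * (i == j)%:R.
  by rewrite -scaleN1r exprZn coefZ coefXn.
case: (ltnP i (size p)) => [lti|gei].
  rewrite (bigD1 (Ordinal lti)) //= coefNX eqxx mulr1 mulrC.
  rewrite big1 ?addr0 // => j neq; rewrite coefNX.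
  by case: eqVneq => [e|]; rewrite ?mulr0 //; case/eqP: neq; apply: val_inj.
rewrite nth_default // mulr0 big1 // => j _.
by rewrite coefNX gtn_eqF ?mulr0 // (leq_trans (ltn_ord j)).
Qed.

Lemma dilB : {morph dil : f g / f - g}.
Proof.
move=> f g; apply: series_eqP => n.
by rewrite coefsB /dil; case: ifP; rewrite ?subrr.
Qed.

Lemma dil_monoid : monoid_morphism dil.
Proof.
split=> [|f g].
  apply: approx_eq => N; exists 1; last exact: approx1.
  by rewrite -[X in approx _ _ X](comp_polyC 1 'X^2); apply/approx_dil/approx1.
apply: approx_eq => N; set T := fun f : series => \poly_(i < N) f i.
exists ((T f * T g) \Po 'X^2); last rewrite comp_polyM;
  by do ?[apply: approxM | apply: approx_dil]; apply: approx_trunc.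
Qed.

HB.instance Definition _ := GRing.isZmodMorphism.Build series series dil dilB.
HB.instance Definition _ := GRing.isMonoidMorphism.Build series series dil dil_monoid.

Lemma altB : {morph alt : f g / f - g}.
Proof. by move=> f g; apply: series_eqP => n; rewrite coefsB /alt mulrBr. Qed.

Lemma alt_monoid : monoid_morphism alt.
Proof.
split=> [|f g].
  by apply: series_eqP => -[|n]; rewrite /alt ?mulr1 // coefs1 mulr0.
apply: series_eqP => n; rewrite /alt !coefsM mulr_sumr; apply: eq_bigr => i _.
by rewrite mulrACA -exprD subnKC // -ltnS.
Qed.

HB.instance Definition _ := GRing.isZmodMorphism.Build series series alt altB.
HB.instance Definition _ := GRing.isMonoidMorphism.Build series series alt alt_monoid.

Lemma altK f : alt (alt f) = f.
Proof.
by apply: series_eqP => n; rewrite /alt mulrA -exprMn mulrNN mulr1 expr1n mul1r.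
Qed.

Lemma alt_q : alt q = - q.
Proof. by apply: series_eqP => -[|[|n]]; rewrite /alt coefsN /q ?mulr0 ?expr1 ?oppr0. Qed.

Lemma alt_dil f : alt (dil f) = dil f.
Proof.
apply: series_eqP => n; rewrite /alt /dil.
case: ifP; rewrite ?mulr0 // dvdn2 => en.
by rewrite -signr_odd (negbTE en) mul1r.
Qed.

Lemma dil_q : dil q = q ^+ 2.
Proof.
apply: series_eqP => n; rewrite expr2 coefs_qM /dil /q.
by case: n => [|[|[|n]]] //; case: ifP => // h; apply/eqP; lia.
Qed.

Lemma dil_inj : injective dil.
Proof.
move=> f g e; apply: series_eqP => n.
by rewrite -dil_even e dil_even.
Qed.

Lemma dil0 f : dil f 0%N = f 0%N. Proof. by []. Qed.
Lemma alt_even f n : ~~ odd n -> alt f n = f n.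
Proof. by move=> en; rewrite /alt -signr_odd (negbTE en) mul1r. Qed.
Lemma alt_odd f n : odd n -> alt f n = - f n.
Proof. by move=> en; rewrite /alt -signr_odd en mulN1r. Qed.

(** The odd coefficients equal their own opposites, so only even exponents remain. *)
Lemma alt_invariant f : alt f = f -> f = dil (fun n => f (2 * n)%N).
Proof.
move=> ef; apply: series_eqP => n; rewrite /dil dvdn2.
case: ifP => [en|/negbFE on]; first by congr (f _); lia.
have := congr1 (fun f : series => f n) ef; rewrite alt_odd //; lia.
Qed.

(** * Theta functions and Euler products *)

Definition poch {R : comNzRingType} (x : R) (n : nat) : R :=
  \prod_(1 <= i < n.+1) (1 - x ^+ i).

Lemma pochS (R : comNzRingType) (x : R) n :
  poch x n.+1 = poch x n * (1 - x ^+ n.+1).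
Proof. by rewrite /poch big_nat_recr. Qed.

Lemma poch0 (R : comNzRingType) (x : R) : poch x 0 = 1.
Proof. by rewrite /poch big_geq. Qed.

(** Finite form of E(q) E(-q) E(q^4) = E(q^2)^3. With y the new odd power of x, the factors 1 - y
    and 1 + y combine to 1 - y^2, while the even power x y contributes equal factors for x and
    -x. *)
Lemma poch_sign (R : comNzRingType) (x : R) n :
  poch x (2 * n) * poch (- x) (2 * n) * poch (x ^+ 4) n
  = poch (x ^+ 2) n ^+ 2 * poch (x ^+ 2) (2 * n).
Proof.
elim: n => [|n IH]; first by rewrite muln0 !poch0; ring.
rewrite mulnS add2n !pochS.
set a := poch x _ in IH *; set b := poch (- x) _ in IH *.
set c := poch (x ^+ 4) _ in IH *; set d := poch (x ^+ 2) n in IH *.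
set e := poch (x ^+ 2) _ in IH *.
set y := x ^+ (2 * n).+1.
have y1 : (- x) ^+ (2 * n).+1 = - y.
  by rewrite exprNn -signr_odd (_ : odd _) ?mulN1r //= mul2n odd_double.
have y2 : x ^+ (2 * n).+2 = x * y by rewrite exprS.
have y3 : (- x) ^+ (2 * n).+2 = x * y by rewrite exprS y1; ring.
have y4 : (x ^+ 4) ^+ n.+1 = (x * y) ^+ 2.
  by rewrite -y2 -!exprM; congr (_ ^+ _); lia.
have y5 : (x ^+ 2) ^+ (2 * n).+2 = (x * y) ^+ 2.
  by rewrite -y2 -!exprM; congr (_ ^+ _); lia.
have y6 : (x ^+ 2) ^+ (2 * n).+1 = y ^+ 2.
  by rewrite -!exprM; congr (_ ^+ _); lia.
have y7 : (x ^+ 2) ^+ n.+1 = x * y.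
  by rewrite -y2 -!exprM; congr (_ ^+ _); lia.
rewrite y1 y2 y3 y4 y5 y6 y7 -/y.
transitivity (a * b * c * (1 - y ^+ 2) * (1 - x * y) ^+ 2 * (1 - (x * y) ^+ 2)).
  by ring.
by rewrite IH; ring.
Qed.

Section Shanks.

Variables (R : comNzRingType) (x : R).

Let plus n : R := \prod_(1 <= i < n.+1) (1 + x ^+ i).
Let mixed n s : R := plus s * \prod_(s.+1 <= i < n.+1) (1 - x ^+ i).

Let plusS n : plus n.+1 = plus n * (1 + x ^+ n.+1).
Proof. by rewrite /plus big_nat_recr. Qed.

Let mixed_nn n : mixed n n = plus n.
Proof. by rewrite /mixed big_geq ?mulr1. Qed.

Let mixedSl n s : (s <= n)%N -> mixed n.+1 s = (1 - x ^+ n.+1) * mixed n s.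
Proof. by move=> lesn; rewrite /mixed big_nat_recr //= mulrA mulrC. Qed.

Let mixedSr n s : (s < n)%N ->
  (1 - x ^+ s.+1) * mixed n s.+1 = (1 + x ^+ s.+1) * mixed n s.
Proof.
move=> ltsn; rewrite /mixed [\prod_(s.+1 <= i < n.+1) _]big_ltn // plusS; ring.
Qed.

(* Equal to 1 + 2 sum_(0 < s < n) (-1)^s x^(s^2) + (-1)^n x^(n^2) for n > 0. *)
Definition theta_sum n : R :=
  \sum_(s < n) (-1) ^+ s * (x ^+ (s ^ 2) - x ^+ (s.+1 ^ 2)).

(* Shanks' identity, multiplied by [plus n]: divided by it, [mixed n s] is P_n / P_s
   for P_n = prod_(i <= n) (1 - x^i) / (1 + x^i). The proof is by telescoping. *)
Let shanks n :
  plus n * theta_sum n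
  = (1 + x ^+ n) * \sum_(0 <= s < n) (-1) ^+ s * x ^+ (n * s) * mixed n s.
Proof.
elim: n => [|n IH]; first by rewrite /theta_sum big_ord0 big_geq // !mulr0.
rewrite /theta_sum big_ord_recr /= -/(theta_sum n) plusS.
rewrite [plus n * _]mulrC -mulrA; congr (_ * _).
rewrite mulrDr IH big_nat_recr //= mixedSl // mixed_nn.
(* By [mixedSl] and [mixedSr], the summand for [n.+1] exceeds 1 + x^n times the summand for [n] by
   e(s+1) - e(s). The factor 1 - x^s makes e(0) = 0. *)
pose e s := (-1) ^+ s * x ^+ (n * s) * (1 - x ^+ s) * mixed n s.
have eS : \sum_(0 <= s < n) (-1) ^+ s * x ^+ (n.+1 * s) * mixed n.+1 s
   = (1 + x ^+ n) * (\sum_(0 <= s < n) (-1) ^+ s * x ^+ (n * s) * mixed n s)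
     + \sum_(0 <= s < n) (e s.+1 - e s).
  rewrite mulr_sumr -big_split /=; apply: eq_big_nat => s /andP[_ ltsn].
  rewrite mixedSl 1?ltnW // /e -[_ * (1 - x ^+ s.+1) * _]mulrA mixedSr //.
  rewrite mulSn mulnS exprD (exprD x n) !exprS.
  move: (mixed n s) (x ^+ s) (x ^+ n) (x ^+ (n * s)) ((-1) ^+ s) => a b c d g.
  by ring.
rewrite eS telescope_sumr // /e expr0 subrr mulr0 mul0r subr0 mixed_nn -!addrA.
congr (_ + _).
have -> : (n.+1 ^ 2 = n * n + n + n + 1)%N by lia.
have -> : (n ^ 2 = n * n)%N by lia.
rewrite mulSn !exprD expr1 (exprS x n).
move: (plus n) (x ^+ n) (x ^+ (n * n)) ((-1) ^+ n) => a b c g.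
ring.
Qed.

(** Finite form of Gauss's product: modulo x^(n+1) only the term s = 0 of Shanks' sum survives, and
    [mixed n.+1 0] is [poch x n.+1]. *)
Lemma theta_sum_poch n :
  exists z, poch (x ^+ 2) n.+1 * theta_sum n.+1 = poch x n.+1 ^+ 2 + x ^+ n.+1 * z.
Proof.
have -> : poch (x ^+ 2) n.+1 = poch x n.+1 * plus n.+1.
  rewrite /poch /plus -big_split /=; apply: eq_bigr => i _.
  by rewrite -exprM mulnC exprM; ring.
rewrite -mulrA shanks big_ltn // muln0 !expr0 !mul1r.
have [z ->] : exists z, \sum_(1 <= s < n.+1) (-1) ^+ s * x ^+ (n.+1 * s) * mixed n.+1 s
    = x ^+ n.+1 * z.
  exists (\sum_(1 <= s < n.+1) (-1) ^+ s * x ^+ (n.+1 * s.-1) * mixed n.+1 s).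
  rewrite mulr_sumr; apply: eq_big_nat => -[|s] // _.
  by rewrite mulnS exprD; ring.
have -> : mixed n.+1 0 = poch x n.+1 by rewrite /mixed /plus big_geq // mul1r.
exists (poch x n.+1 * (poch x n.+1 + z + x ^+ n.+1 * z)).
by ring.
Qed.

End Shanks.

Arguments theta_sum {R} x n.

Definition euler : series := pcoef 1.

Lemma approx_euler N M : (N <= M.+1)%N -> approx N euler (poch 'X M).
Proof.
move=> leNM i ltiN; rewrite /euler -(@pcoef_stable _ _ M); last by lia.
by congr (_`_i); apply: eq_bigr => j _; rewrite expr1.
Qed.

Lemma euler0 : euler 0%N = 1.
Proof. by rewrite (@approx_euler 1 0) // poch0 coef1. Qed.

Lemma coefs_eulerX j n : (euler ^+ j) n = pcoef j n.
Proof.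
rewrite (@approxX n.+1 _ (poch 'X n)) //; last exact: approx_euler.
by rewrite /pcoef -prodrXl.
Qed.

Lemma comp_poch (p y : {poly int}) n : poch p n \Po y = poch (p \Po y) n.
Proof.
rewrite /poch; elim/big_rec2: _ => [|i a b _ <-]; first by rewrite comp_polyC.
by rewrite comp_polyM comp_polyB comp_polyC rmorphXn.
Qed.

Lemma approx_dil_euler N M : (N <= M.+1)%N -> approx N (dil euler) (poch ('X ^+ 2) M).
Proof.
move=> h; have := @approx_dil _ _ _ (approx_euler _ _ h).
by rewrite comp_poch comp_polyX.
Qed.

(** Limit of [poch_sign]: 2 N factors in q and N factors in q^4 determine all coefficients below
    N. *)
Lemma euler_sign : euler * alt euler * dil (dil euler) = dil euler ^+ 3.
Proof.
apply: approx_eq => N.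
have NN : (N <= (2 * N).+1)%N by lia.
exists (poch 'X (2 * N) * poch (- 'X) (2 * N) * poch ('X ^+ 4) N).
  apply: approxM; [apply: approxM|]; first exact: approx_euler.
    have := @approx_alt _ _ _ (approx_euler _ _ NN).
    by rewrite comp_poch comp_polyX.
  have := @approx_dil _ _ _ (approx_dil_euler _ _ (leqnSn N)).
  by rewrite comp_poch rmorphXn /= comp_polyX -exprM.
rewrite poch_sign (exprSr (dil euler)).
apply: approxM; last exact: approx_dil_euler _ _ NN.
exact/approxX/(approx_dil_euler _ _ (leqnSn N)).
Qed.

(** * Theta series of squares and triangular numbers, and Gauss's product *)

Definition is_square (n : nat) : bool := [exists j : 'I_n.+1, n == (j ^ 2)%N].

Lemma is_squareP n : reflect (exists j, n = (j ^ 2)%N) (is_square n).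
Proof.
apply: (iffP existsP) => [[j /eqP ->]|[j e]]; first by exists j.
have ltj : (j < n.+1)%N by rewrite e; nia.
by exists (Ordinal ltj); rewrite -e.
Qed.

(** A positive square has two integer roots, 0 only one. *)
Definition phi : series := fun n => if n is 0%N then 1 else 2 * (is_square n)%:R.

(* 8 n + 1 is a square iff n is a triangular number. *)
Definition psi : series := fun n => (is_square (8 * n + 1))%:R.

Lemma is_square_mul4 n : is_square (4 * n) = is_square n.
Proof.
apply/is_squareP/is_squareP => -[j e]; last by exists (2 * j)%N; rewrite e expnMn.
have ej : (j = 2 * (j %/ 2) + j %% 2)%N by lia.
have lj : (j %% 2 < 2)%N by lia.
exists (j %/ 2)%N; move: (j %/ 2)%N (j %% 2)%N ej lj e => a b -> ltb.
by rewrite -!mulnn; case: b ltb => [|[|b]] //; nia.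
Qed.

Lemma is_square_mod n : is_square n -> (n %% 4 = 0 \/ n %% 8 = 1)%N.
Proof.
case/is_squareP => j ->.
have [[i ->]|[i ->]] : (exists i, j = 2 * i)%N \/ (exists i, j = 2 * i + 1)%N.
- have := odd_double_half j; case: (odd j) => /= e;
    [right | left]; exists j./2; lia.
- by left; rewrite expnMn mulnC modnMl.
- right; have [t et] : exists t, (i * (i + 1) = 2 * t)%N.
    by exists ((i * (i + 1))./2); have := odd_double_half (i * (i + 1));
       rewrite oddM oddD; case: (odd i); lia.
  by rewrite (_ : ((2 * i + 1) ^ 2 = t * 8 + 1)%N) ?modnMDl // -mulnn; nia.
Qed.

Lemma coefs_dil f n : dil f n = if (2 %| n)%N then f (n %/ 2)%N else 0.
Proof. by []. Qed.

Lemma coefs_dil2 f n :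
  dil (dil f) n = if (4 %| n)%N then f (n %/ 4)%N else 0.
Proof.
rewrite !coefs_dil; case: ifP => h2; case: (boolP (4 %| n)%N) => h4 //; try by lia.
  by rewrite ifT; [congr (f _); lia | lia].
by rewrite ifF //; lia.
Qed.

(** Even squares 4 j^2 give phi(q^4); odd squares are 8 t + 1 with t triangular and give 2 q
    psi(q^8). *)
Lemma phi_dissection : phi = dil (dil phi) + 2%:R * (q * dil (dil (dil psi))).
Proof.
apply: series_eqP => n; rewrite coefsD coefs_natM coefs_qM coefs_dil2.
case: n => [|n]; first by rewrite mulr0 addr0.
have nsq k : (k %% 4 != 0 -> k %% 8 != 1 -> is_square k = false)%N.
  by case E: (is_square k) => //; have := is_square_mod _ E; lia.
have [[m ->]|[[m ->]|[h h']]] : (exists m, n = 4 * m + 3)%N \/ (exists m, n = 8 * m)%N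
    \/ (n.+1 %% 4 <> 0 /\ n.+1 %% 8 <> 1)%N.
- case: (eqVneq (n.+1 %% 4)%N 0%N) => h; first by left; exists (n %/ 4)%N; lia.
  case: (eqVneq (n.+1 %% 8)%N 1%N) => h'; first by right; left; exists (n %/ 8)%N; lia.
  by right; right; split; apply/eqP.
- rewrite ifT; last by lia.
  rewrite coefs_dil2 ifF; last by lia.
  rewrite mulr0 addr0 (_ : (4 * m + 3).+1 = (4 * m.+1)%N); last by lia.
  rewrite mulKn // /phi -(is_square_mul4 m.+1).
  by rewrite (_ : (4 * m.+1 = (4 * m + 3).+1)%N); last by lia.
- rewrite ifF; last by lia.
  rewrite coefs_dil2 ifT; last by lia.
  rewrite coefs_dil ifT; last by lia.
  by rewrite add0r /phi /psi; congr (2 * (is_square _)%:R); lia.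
- rewrite ifF; last by lia.
  rewrite add0r /phi nsq ?mulr0 //; [|by apply/eqP|by apply/eqP].
  rewrite coefs_dil2; case: ifP => // h4; rewrite coefs_dil ifF ?mulr0 //; lia.
Qed.

(** A square j^2 with j > 0 occurs for s = j and for s = j - 1, each time with sign (-1)^j, and j^2
    has the parity of j; 0 occurs once. The incomplete last term has degree N^2, outside the
    range. *)
Lemma approx_alt_phi N : approx N (alt phi) (theta_sum 'X N).
Proof.
move=> i ltiN; rewrite /theta_sum coef_sum.
have coefE (s : nat) : ((-1) ^+ s * ('X ^+ (s ^ 2) - 'X ^+ (s.+1 ^ 2)) : {poly int})`_i
   = (-1) ^+ s * ((i == s ^ 2)%N%:R - (i == s.+1 ^ 2)%N%:R).
  rewrite -(signr_odd _ s) -[in RHS](signr_odd _ s) !mulr_sign.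
  by case: (odd s); rewrite ?coefN coefB !coefXn.
under eq_bigr do rewrite coefE mulrBr.
rewrite sumrB.
case: (boolP (is_square i)) => [/is_squareP[j ij]|nsq]; last first.
  rewrite !big1 => [|s _|s _].
  - rewrite subrr /alt /phi; case: i ltiN nsq {coefE} => [_|i _ /negbTE->].
      by case/is_squareP; exists 0%N.
    by rewrite !mulr0.
  - by case: eqVneq => [e|]; rewrite ?mulr0 //; case/is_squareP: nsq; exists s.+1.
  - by case: eqVneq => [e|]; rewrite ?mulr0 //; case/is_squareP: nsq; exists s.
have sqr_inj (a b : nat) : (a ^ 2 == b ^ 2)%N = (a == b) by rewrite eqn_exp2r.
have ltj : (j < N)%N by nia.
have alti : (-1) ^+ i = (-1) ^+ j :> int.
  by rewrite -[LHS]signr_odd -[RHS]signr_odd ij oddX.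
rewrite (bigD1 (Ordinal ltj)) //= big1 => [|s neq]; last first.
  rewrite ij sqr_inj; case: eqVneq => [e|]; rewrite ?mulr0 //.
  by case/eqP: neq; apply: val_inj.
rewrite -ij eqxx mulr1 addr0 /alt alti.
case: j => [|j] in ij ltj alti *.
  rewrite ij big1 ?subr0 ?mulr1 // => s _.
  by rewrite (_ : (0 == s.+1 ^ 2)%N = false) ?mulr0 //; lia.
have ltj' : (j < N)%N by lia.
rewrite (bigD1 (Ordinal ltj')) //= big1 => [|s neq]; last first.
  rewrite ij sqr_inj; case: eqVneq => [e|]; rewrite ?mulr0 //.
  by case: e => e; case/eqP: neq; apply: val_inj.
rewrite -ij eqxx mulr1 addr0.
have -> : phi i = 2.
  have : is_square i by apply/is_squareP; exists j.+1.
  by rewrite /phi; case: i {coefE ltiN alti} ij => [|i] ij; [lia | move=> ->].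
by rewrite exprS; ring.
Qed.

Lemma gauss : alt phi * dil euler = euler ^+ 2.
Proof.
apply: approx_eq => -[|N]; first by exists 0.
exists (theta_sum 'X N.+1 * poch ('X ^+ 2) N.+1).
  by apply: approxM; [apply: approx_alt_phi | apply: approx_dil_euler].
have [z e] := @theta_sum_poch {poly int} 'X N.
rewrite mulrC e => i ltiN.
rewrite (@approxX N.+1 _ (poch 'X N.+1)) //; last by apply: approx_euler; lia.
by rewrite coefD ['X^_ * z]mulrC coefMXn ltiN addr0.
Qed.

Lemma psi0 : psi 0%N = 1.
Proof. by rewrite /psi; case: is_squareP => // -[]; exists 1%N. Qed.

(** * Jacobi's identity and the recurrences *)

Lemma alt_dissection : alt phi = dil (dil phi) - 2%:R * (q * dil (dil (dil psi))).
Proof.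
by rewrite {1}phi_dissection !(rmorphXn, rmorphB, rmorphD, rmorphM, rmorph_nat) /= alt_q !alt_dil; ring.
Qed.

Lemma gauss_alt : phi * dil euler = alt euler ^+ 2.
Proof. by rewrite -rmorphXn -gauss rmorphM /= altK alt_dil. Qed.

(** Multiplied by E(q^2)^2 E(q^4)^2, both sides become E(q^2)^6 by [gauss], [gauss_alt] and
    [euler_sign]. *)
Lemma phi_alt : phi * alt phi = dil (alt phi) ^+ 2.
Proof.
apply: (@series_cancel (dil euler ^+ 2 * dil (dil euler) ^+ 2)).
  by rewrite coefsM0 !coefsX0 !dil0 euler0.
transitivity ((phi * dil euler) * (alt phi * dil euler) * dil (dil euler) ^+ 2).
  by ring.
rewrite gauss gauss_alt.
transitivity ((euler * alt euler * dil (dil euler)) ^+ 2); first by ring.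
rewrite euler_sign.
transitivity (dil euler ^+ 2 * (dil (alt phi * dil euler)) ^+ 2).
  by rewrite gauss rmorphXn /=; ring.
by rewrite rmorphM /=; ring.
Qed.

(** After q -> q^2 the left side is the product of the dissections of phi(q) and phi(-q), which
    [phi_alt] evaluates. *)
Lemma dil_phi_sqr : dil phi ^+ 2 - 4%:R * q * dil (dil psi) ^+ 2 = alt phi ^+ 2.
Proof.
apply: dil_inj; rewrite !(rmorphXn, rmorphB, rmorphD, rmorphM, rmorph_nat) /= dil_q.
by rewrite -phi_alt alt_dissection [X in _ = X * _]phi_dissection; ring.
Qed.

Lemma dil_phi_sqr_alt : dil phi ^+ 2 + 4%:R * q * dil (dil psi) ^+ 2 = phi ^+ 2.
Proof.
have := congr1 alt dil_phi_sqr.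
rewrite !(rmorphXn, rmorphB, rmorphD, rmorphM, rmorph_nat) /= alt_q !alt_dil altK => <-; ring.
Qed.

(** After q -> q^2, phi(-q^2)^4 = phi(q)^2 phi(-q)^2 is the product of a sum and a difference, by
    the two preceding identities. *)
Lemma phi_pow4 : phi ^+ 4 - alt phi ^+ 4 = 16%:R * q * dil psi ^+ 4.
Proof.
have e : dil (alt phi ^+ 4) = dil (phi ^+ 4 - 16%:R * q * dil psi ^+ 4).
  rewrite !(rmorphXn, rmorphB, rmorphD, rmorphM, rmorph_nat) /= dil_q.
  transitivity ((phi * alt phi) ^+ 2); first by rewrite phi_alt; ring.
  by rewrite exprMn -dil_phi_sqr_alt -dil_phi_sqr; ring.
by rewrite (dil_inj _ _ e); ring.
Qed.

(** After q -> q^2 and multiplication by 16 q, the left side is the difference of fourth powers in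
    [phi_pow4], which factors into the difference and the sum of phi(q)^2 and phi(-q)^2. *)
Lemma psi_pow4 : psi ^+ 4 = phi ^+ 2 * dil psi ^+ 2.
Proof.
apply/dil_inj/q_cancel/(@series_cancel 16%:R) => //.
rewrite !(rmorphXn, rmorphB, rmorphD, rmorphM, rmorph_nat) /= mulrA -phi_pow4.
transitivity ((phi ^+ 2 - alt phi ^+ 2) * (phi ^+ 2 + alt phi ^+ 2)); first by ring.
by rewrite -dil_phi_sqr_alt -dil_phi_sqr; ring.
Qed.

(* For F = f / g the hypothesis reads F(q)^4 = F(q^2)^2; if F = 1 + c q^n + ...
   with n > 0 then 4 c q^n is the first term of F(q)^4 - 1 but F(q^2)^2 - 1 is
   O(q^(2n)), so that c = 0. *)
Lemma dil_unique (f g : series) : f 0%N = 1 -> g 0%N = 1 ->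
  f ^+ 4 * dil g ^+ 2 = g ^+ 4 * dil f ^+ 2 -> f = g.
Proof.
move=> f0 g0 e.
suff H n : (0 < n)%N -> exists h, f - g = q ^+ n * h.
  apply: series_eqP => n; have [h fg] := H n.+1 isT.
  apply/eqP; rewrite -subr_eq0 -coefsB fg.
  elim: n h {fg} => [|n IH] h; first by rewrite expr1 coefs_qM.
  by rewrite exprS -mulrA coefs_qM.
have divq h : h 0%N = 0 -> exists h', h = q * h'.
  move=> h0; exists (fun i => h i.+1); apply: series_eqP => i.
  by rewrite coefs_qM; case: i.
case: n => // n _; elim: n => [|n [h fg]].
  have [|h ->] := divq (f - g); first by rewrite coefsB f0 g0.
  by exists h; rewrite expr1.
suff /divq[h' hE] : h 0%N = 0 by exists h'; rewrite fg hE [in RHS]exprSr mulrA.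
have fE : f = g + q ^+ n.+1 * h by rewrite -fg; ring.
have dfE : dil f = dil g + q ^+ n.+1 * (q ^+ n.+1 * dil h).
  rewrite fE rmorphD rmorphM rmorphXn /= dil_q -exprM mul2n -addnn exprD; ring.
have qn u v : q ^+ n.+1 * u = q ^+ n.+1 * v -> u = v.
  by elim: (n.+1) => [|k IH]; rewrite ?expr0 ?mul1r // exprS -!mulrA => /q_cancel.
set y := q ^+ n.+1 in fE dfE qn.
have y0 : y 0%N = 0 by rewrite /y exprS coefsM0 mul0r.
have e' : y * (h * (f ^+ 3 + f ^+ 2 * g + f * g ^+ 2 + g ^+ 3) * dil g ^+ 2)
        = y * (y * (g ^+ 4 * dil h * (dil f + dil g))).
  transitivity (f ^+ 4 * dil g ^+ 2 - g ^+ 4 * dil g ^+ 2); first by rewrite fE; ring.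
  by rewrite e dfE; ring.
have /(congr1 (fun f : series => f 0%N)) := qn _ _ e'.
rewrite [RHS]coefsM0 y0 mul0r !coefsM0 !coefsD !coefsM0 !coefsX0 !dil0 f0 g0.
by rewrite !expr1n !mulr1 => /eqP; rewrite mulf_eq0 orbF => /eqP.
Qed.

(** Gauss's product for psi. By [psi_pow4], both sides satisfy the functional equation that
    [dil_unique] shows to have one solution. *)
Lemma psi_euler : psi * euler = dil euler ^+ 2.
Proof.
apply: dil_unique.
- by rewrite coefsM0 psi0 euler0.
- by rewrite coefsX0 dil0 euler0.
apply: (@series_cancel (dil (dil euler) ^+ 2)).
  by rewrite coefsX0 !dil0 euler0.
rewrite !(rmorphXn, rmorphM) /= [(psi * euler) ^+ 4]exprMn psi_pow4.
(* The product phi(q) = E(q^2)^5 / (E(q)^2 E(q^4)^2), cleared of denominators. *)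
have h : phi * euler ^+ 2 * dil (dil euler) ^+ 2 = dil euler ^+ 5.
  apply: (@series_cancel (dil euler)); first by rewrite dil0 euler0.
  transitivity ((euler * alt euler * dil (dil euler)) ^+ 2).
    transitivity (euler ^+ 2 * alt euler ^+ 2 * dil (dil euler) ^+ 2); last by ring.
    by rewrite -gauss_alt; ring.
  by rewrite euler_sign; ring.
transitivity ((phi * euler ^+ 2 * dil (dil euler) ^+ 2) ^+ 2
              * dil (dil euler) ^+ 2 * dil psi ^+ 2); first by ring.
by rewrite h; ring.
Qed.

(* Jacobi's "aequatio identica satis abstrusa", cleared of denominators. *)
Lemma jacobi : euler ^+ 8 - alt euler ^+ 8 = - (16%:R * q * dil (dil euler ^+ 8)).
Proof.
transitivity (- ((phi ^+ 4 - alt phi ^+ 4) * dil euler ^+ 4)).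
  transitivity ((euler ^+ 2) ^+ 4 - (alt euler ^+ 2) ^+ 4); first by ring.
  by rewrite -gauss -gauss_alt; ring.
rewrite phi_pow4; congr (- _).
transitivity (16%:R * q * dil ((psi * euler) ^+ 4)).
  by rewrite !(rmorphXn, rmorphM) /=; ring.
by rewrite psi_euler -exprM.
Qed.

(** * Recurrences for the coefficients of E^8, E^24 and E^16 *)

Lemma sub_alt_odd (f : series) n : (f - alt f) (2 * n).+1 = 2 * f (2 * n).+1.
Proof. by rewrite coefsB alt_odd; [ring | rewrite /= mul2n odd_double]. Qed.

Lemma add_alt_even (f : series) n : (f + alt f) (2 * n)%N = 2 * f (2 * n)%N.
Proof. by rewrite coefsD alt_even; [ring | rewrite mul2n odd_double]. Qed.

Lemma p8_odd l : pcoef 8 (2 * l).+1 = - 8 * dil (euler ^+ 8) l.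
Proof.
apply: (@mulfI _ 2) => //; rewrite -coefs_eulerX -sub_alt_odd rmorphXn /= jacobi.
rewrite coefsN -mulrA coefs_natM coefs_qM dil_even rmorphXn /=; ring.
Qed.

(** Eighth power of [euler_sign]; it evaluates the norm E(q)^8 E(-q)^8 once the factor E(q^4)^8 is
    present. *)
Lemma euler8_norm :
  euler ^+ 8 * alt euler ^+ 8 * dil (dil (euler ^+ 8)) = dil (euler ^+ 24).
Proof.
by rewrite !rmorphXn /= -!exprMn euler_sign -exprM.
Qed.

(** For u = E(q)^8 and v = E(-q)^8, u^3 - v^3 = (u - v)^3 + 3 (u - v) u v. Jacobi's identity gives u
    - v, whose factor E(q^4)^8 is what [euler8_norm] needs to evaluate u v. *)
Lemma euler24_odd_part :
  euler ^+ 24 - alt euler ^+ 24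
  = q * dil (- (48%:R * euler ^+ 24) - 2%:R ^+ 12 * (q * dil (euler ^+ 24))).
Proof.
transitivity ((euler ^+ 8 - alt euler ^+ 8) ^+ 3
   + 3%:R * (euler ^+ 8 - alt euler ^+ 8) * (euler ^+ 8 * alt euler ^+ 8)).
  by ring.
rewrite jacobi.
transitivity (- (2%:R ^+ 12 * (q * dil q * dil (dil (euler ^+ 24)))) - 48%:R * q *
  (euler ^+ 8 * alt euler ^+ 8 * dil (dil (euler ^+ 8)))).
  by rewrite dil_q; ring.
by rewrite euler8_norm; ring.
Qed.

Lemma p24_odd l :
  pcoef 24 (2 * l).+1 = - 24 * pcoef 24 l - 2 ^+ 11 * (q * dil (euler ^+ 24)) l.
Proof.
apply: (@mulfI _ 2) => //; rewrite -!coefs_eulerX -sub_alt_odd rmorphXn /=.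
rewrite euler24_odd_part coefs_qMS dil_even coefsB coefsN coefs_natM -natrX coefs_natM natrX.
by ring.
Qed.

(** C is E(q)^24 / E(q^2)^8, obtained without division: the norm is invariant under q -> -q, hence a
    series in q^2. *)
Lemma euler8_half_norm : exists C : series,
  euler ^+ 8 * alt euler ^+ 8 = dil C /\ C * dil (euler ^+ 8) = euler ^+ 24.
Proof.
have inv : alt (euler ^+ 8 * alt euler ^+ 8) = euler ^+ 8 * alt euler ^+ 8.
  by rewrite !(rmorphXn, rmorphM) /= altK mulrC.
have e := alt_invariant _ inv; set C := (X in dil X) in e.
exists C; split=> //; apply: dil_inj.
by rewrite rmorphM /= -e euler8_norm.
Qed.

(** Three dissections lead from index 8 s + 2 to 4 s + 1, 2 s and s: the even part of E^16 involves
    C, the odd part of C involves M, and the odd part of M returns to E^16. *)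
Lemma p16_recurrence s :
  pcoef 16 (8 * s + 2)
  = 104 * pcoef 16 (2 * s) - 2 ^+ 14 * (q * dil (euler ^+ 16)) s.
Proof.
have [C [dilC CV]] := euler8_half_norm.
have even_part : euler ^+ 16 + alt euler ^+ 16
    = dil (2%:R * (128%:R * (q * dil (euler ^+ 16)) + C)).
  transitivity ((euler ^+ 8 - alt euler ^+ 8) ^+ 2
    + 2%:R * (euler ^+ 8 * alt euler ^+ 8)); first by ring.
  rewrite jacobi dilC.
  transitivity (256%:R * dil q * dil (dil (euler ^+ 8)) ^+ 2 + 2%:R * dil C).
    by rewrite dil_q; ring.
  by ring.
(* M is E(q^2)^24 / E(q)^8, so dividing [euler24_odd_part] by E(q^2)^8 leaves integral series. *)
pose M := alt euler ^+ 8 * dil (dil (euler ^+ 8)).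
have ME : euler ^+ 8 * M = dil (euler ^+ 24) by rewrite /M mulrA euler8_norm.
have C_odd : C - alt C = q * dil (- (48%:R * euler ^+ 16) - 2%:R ^+ 12 * (q * M)).
  apply: (@series_cancel (dil (euler ^+ 8))); first by rewrite dil0 coefsX0 euler0.
  transitivity (euler ^+ 24 - alt euler ^+ 24).
    by rewrite -[alt euler ^+ 24]rmorphXn -CV rmorphM /= alt_dil; ring.
  by rewrite euler24_odd_part -ME; ring.
have M_odd : M - alt M = q * dil (16%:R * dil (euler ^+ 16)).
  have -> : alt M = euler ^+ 8 * dil (dil (euler ^+ 8)).
    transitivity (alt (alt euler) ^+ 8 * alt (dil (dil (euler ^+ 8)))).
      by rewrite /M; ring.
    by rewrite altK alt_dil.
  transitivity (- ((euler ^+ 8 - alt euler ^+ 8) * dil (dil (euler ^+ 8)))).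
    by rewrite /M; ring.
  by rewrite jacobi; ring.
have qM : 2 * (q * M) (2 * s)%N = 16 * (q * dil (euler ^+ 16)) s.
  case: s => [|s]; first by rewrite !coefsM0 !mul0r.
  rewrite (_ : (2 * s.+1 = (2 * s).+2)%N) ?coefs_qMS; last by lia.
  by rewrite -sub_alt_odd M_odd coefs_qMS dil_even coefs_natM.
have C4 : 2 * C (4 * s).+1 = - 48 * pcoef 16 (2 * s)
    - 2 ^+ 12 * (q * M) (2 * s)%N.
  rewrite (_ : ((4 * s).+1 = (2 * (2 * s)).+1)%N); last by lia.
  rewrite -sub_alt_odd C_odd coefs_qMS dil_even coefsB coefsN coefs_natM -natrX.
  by rewrite coefs_natM natrX coefs_eulerX; ring.
have p16 : pcoef 16 (8 * s + 2) = 128 * pcoef 16 (2 * s) + C (4 * s).+1.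
  apply: (@mulfI _ 2) => //; rewrite (_ : (8 * s + 2 = 2 * (4 * s).+1)%N); last by lia.
  rewrite -!coefs_eulerX -add_alt_even rmorphXn /= even_part dil_even coefs_natM.
  rewrite coefsD coefs_natM coefs_qMS (_ : (4 * s = 2 * (2 * s))%N); last by lia.
  by rewrite dil_even.
(* The factor 4 clears the halves in [C4] and [qM]; in the end 128 - 24 = 104 and 2^11 * 8 =
   2^14. *)
apply: (@mulfI _ 4) => //; rewrite p16.
transitivity (512 * pcoef 16 (2 * s) + 2 * (2 * C (4 * s).+1)); first by ring.
rewrite C4.
transitivity (416 * pcoef 16 (2 * s) - 2 ^+ 12 * (2 * (q * M) (2 * s)%N)); first by ring.
by rewrite qM; ring.
Qed.

(* Coefficients of the expansion of [eta(3 z)^(8 k)], and of [eta(6 z)^(8 k)]. *)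
Definition eta_coef (k N : nat) : int :=
  if (k <= N)%N && (3 %| N - k)%N then pcoef (8 * k) ((N - k) %/ 3) else 0.

Definition eta2_coef (k N : nat) : int :=
  if (2 %| N)%N then eta_coef k (N %/ 2) else 0.

Lemma eta_coefE k t : eta_coef k (3 * t + k) = pcoef (8 * k) t.
Proof. by rewrite /eta_coef leq_addl addnK dvdn_mulr // mulKn. Qed.

Lemma eta2_coef_double k n : eta2_coef k (2 * n) = eta_coef k n.
Proof. by rewrite /eta2_coef dvdn_mulr // mulKn. Qed.

Lemma eta2_coef_odd k n : odd n -> eta2_coef k n = 0.
Proof. by rewrite /eta2_coef dvdn2 => ->. Qed.

(** The expansion of eta(6 z)^(8 k) starts at q^(2 k), whence the shift by 2 k. *)
Lemma eta2_coefE k l : eta2_coef k (3 * l + 2 * k) = dil (euler ^+ (8 * k)) l.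
Proof.
rewrite coefs_dil; case: ifP => [h|h].
  have -> : (3 * l + 2 * k = 2 * (3 * (l %/ 2) + k))%N by lia.
  by rewrite eta2_coef_double eta_coefE coefs_eulerX.
by rewrite eta2_coef_odd //; lia.
Qed.

Lemma eta_coef_eq0 k n : (n < k)%N || ~~ (3 %| n - k)%N -> eta_coef k n = 0.
Proof. by rewrite /eta_coef; case: leqP => //= _ /negbTE->. Qed.

Lemma eta2_coef_eq0 k n : (n < 2 * k)%N || ~~ (3 %| n - 2 * k)%N -> eta2_coef k n = 0.
Proof. by rewrite /eta2_coef; case: ifP => // h h'; rewrite eta_coef_eq0 //; lia. Qed.

(** For n = 3 l + 2 this is [p8_odd]; in the other residue classes modulo 3 both sides vanish. *)
Lemma eta8_double n : eta_coef 1 (2 * n) = - 8 * eta2_coef 1 n.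
Proof.
have [[l ->]|h] : (exists l, n = 3 * l + 2 * 1)%N \/ (n %% 3 != 2)%N.
- by case: (eqVneq (n %% 3)%N 2%N) => h; [left; exists (n %/ 3)%N; lia | right].
- rewrite eta2_coefE (_ : (2 * _ = 3 * (2 * l).+1 + 1)%N); last by lia.
  by rewrite eta_coefE -p8_odd.
- by rewrite eta_coef_eq0 ?eta2_coef_eq0 ?mulr0 //; lia.
Qed.

Lemma eta16_mul8 n :
  eta_coef 2 (8 * n) = 104 * eta_coef 2 (2 * n) - 2 ^+ 14 * eta2_coef 2 n.
Proof.
have [[s ->]|h] : (exists l, n = 3 * l + 1)%N \/ (n %% 3 != 1)%N.
- by case: (eqVneq (n %% 3)%N 1%N) => h; [left; exists (n %/ 3)%N; lia | right].
- rewrite (_ : (8 * _ = 3 * (8 * s + 2) + 2)%N); last by lia.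
  rewrite (_ : (2 * _ = 3 * (2 * s) + 2)%N); last by lia.
  rewrite !eta_coefE -[(8 * 2)%N]/16%N p16_recurrence.
  (* s = 0 means n = 1, below the first exponent 4 of eta(6 z)^16. *)
  congr (_ - _ * _); case: s => [|s]; first by rewrite eta2_coef_eq0 // coefsM0 mul0r.
  by rewrite coefs_qMS (_ : (3 * s.+1 + 1 = 3 * s + 2 * 2)%N) ?eta2_coefE //; lia.
- by rewrite !eta_coef_eq0 ?eta2_coef_eq0 ?mulr0 //; lia.
Qed.

Lemma eta24_double n :
  eta_coef 3 (2 * n) = - 24 * eta_coef 3 n - 2 ^+ 11 * eta2_coef 3 n.
Proof.
(* n = 0 is set apart: it is a multiple of 3 below the first exponent 3. *)
have [[s ->]|h] : (exists l, n = 3 * l + 3)%N \/ (n == 0 \/ n %% 3 != 0)%N.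
- case: (eqVneq (n %% 3)%N 0%N) => h; last by right; right.
  by case: (eqVneq n 0%N) => h'; [right; left | left; exists (n %/ 3).-1; lia].
- rewrite (_ : (2 * _ = 3 * (2 * s).+1 + 3)%N); last by lia.
  rewrite !eta_coefE -[(8 * 3)%N]/24%N p24_odd.
  congr (_ - _ * _); case: s => [|s]; first by rewrite eta2_coef_eq0 // coefsM0 mul0r.
  by rewrite coefs_qMS (_ : (3 * s.+1 + 3 = 3 * s + 2 * 3)%N) ?eta2_coefE //; lia.
- by rewrite !eta_coef_eq0 ?eta2_coef_eq0 ?mulr0 //; lia.
Qed.

(** * Reduction modulo m *)

Lemma A_rec k j : (1 <= k <= 3)%N ->
  A k (2 * j + 5) = fcoef k * A k (2 * j + 3) + gcoef k * A k (2 * j + 1).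
Proof. by rewrite !addnS addn0; case: k => [|[|[|[|]]]]. Qed.

Lemma B_rec k j : (1 <= k <= 3)%N ->
  B k (2 * j + 5) = fcoef k * B k (2 * j + 3) + gcoef k * B k (2 * j + 1).
Proof. by rewrite !addnS addn0; case: k => [|[|[|[|]]]]. Qed.

Lemma k_cases k : (1 <= k <= 3)%N -> [\/ k = 1, k = 2 | k = 3]%N.
Proof. by case: k => [|[|[|[|]]]] // _; [apply: Or31 | apply: Or32 | apply: Or33]. Qed.

(* The recurrences also hold one step earlier, with [A k (-1) = 1] and
   [B k (-1) = 0]. *)
Lemma A3E k : (1 <= k <= 3)%N -> A k 3 = fcoef k * A k 1 + gcoef k.
Proof.
case/k_cases=> ->; rewrite /fcoef /gcoef.
- rewrite -[A 1 3]/64 -[A 1 1]/(- 8); ring.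
- rewrite -[A 2 3]/(- 3072) -[A 2 1]/128; ring.
- rewrite -[A 3 3]/(23 * 2 ^+ 17) -[A 3 1]/(- 2048); ring.
Qed.

Lemma B3E k : (1 <= k <= 3)%N -> B k 3 = fcoef k * B k 1.
Proof.
case/k_cases=> ->; rewrite /fcoef.
- rewrite -[B 1 3]/0 -[B 1 1]/0; ring.
- rewrite -[B 2 3]/104 -[B 2 1]/1; ring.
- rewrite -[B 3 3]/(165 * 2 ^+ 9) -[B 3 1]/(- 24); ring.
Qed.

Lemma eta_mul8 k n : (1 <= k <= 3)%N ->
  eta_coef k (8 * n) = fcoef k * eta_coef k (2 * n) + gcoef k * eta2_coef k n.
Proof.
case/k_cases=> ->; rewrite /fcoef /gcoef.
- rewrite (_ : (8 * n = 2 * (2 * (2 * n)))%N); last by lia.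
  by rewrite eta8_double eta2_coef_double; ring.
- by rewrite eta16_mul8; ring.
- rewrite (_ : (8 * n = 2 * (2 * (2 * n)))%N); last by lia.
  rewrite 2!eta24_double !eta2_coef_double.
  (* Eliminating a(2 n) leaves a combination of a(n) and a(n / 2) on each side. *)
  have -> : eta_coef 3 (2 * n) = - 24 * eta_coef 3 n - 2 ^+ 11 * eta2_coef 3 n.
    exact: eta24_double.
  by ring.
Qed.

Lemma eta_double k n : (1 <= k <= 3)%N ->
  exists b, eta_coef k (2 * n) = A k 1 * eta2_coef k n + B k 1 * b.
Proof.
case/k_cases=> ->.
- by exists 0; rewrite -[A 1 1]/(- 8) eta8_double mulr0 addr0.
(* Since [B 2 1] is 1, the difference itself serves as b. *)
- exists (eta_coef 2 (2 * n) - 128 * eta2_coef 2 n).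
  by rewrite -[A 2 1]/128 -[B 2 1]/1; ring.
- exists (eta_coef 3 n); rewrite -[A 3 1]/(- 2048) -[B 3 1]/(- 24) eta24_double.
  by ring.
Qed.

(** By [eta_mul8] the left side obeys the recurrence of A and B, so the b of [eta_double] serves for
    every j; two consecutive odd exponents are carried through the induction. *)
Lemma eta_pow2 k n j : (1 <= k <= 3)%N ->
  exists b, eta_coef k (2 ^ (2 * j + 1) * n)
            = A k (2 * j + 1) * eta2_coef k n + B k (2 * j + 1) * b.
Proof.
move=> hk; have [b hb] := eta_double _ n hk; exists b.
suff [] : eta_coef k (2 ^ (2 * j + 1) * n)
            = A k (2 * j + 1) * eta2_coef k n + B k (2 * j + 1) * b
  /\ eta_coef k (2 ^ (2 * j + 3) * n)
            = A k (2 * j + 3) * eta2_coef k n + B k (2 * j + 3) * b by [].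
elim: j => [|j [IH1 IH2]].
  rewrite muln0 !add0n expn1 -[(2 ^ 3)%N]/8%N eta_mul8 // A3E // B3E // hb.
  by split=> //; ring.
rewrite (_ : (2 * j.+1 + 1 = 2 * j + 3)%N); last by lia.
rewrite (_ : (2 * j.+1 + 3 = 2 * j + 5)%N); last by lia.
split=> //.
have -> : (2 ^ (2 * j + 5) * n = 8 * (2 ^ (2 * j + 2) * n))%N.
  by rewrite mulnA -[8%N]/(2 ^ 3)%N -expnD; congr (2 ^ _ * _)%N; lia.
rewrite eta_mul8 // mulnA -expnS -addnS IH2.
have -> : (2 ^ (2 * j + 2) * n = 2 * (2 ^ (2 * j + 1) * n))%N.
  by rewrite mulnA -expnS -addnS.
by rewrite eta2_coef_double IH1 A_rec // B_rec //; ring.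
Qed.

(** The isolated factor 2 is the one that [eta2_coef_double] absorbs between two rounds of [mu]. *)
Lemma pow2_addB1 a b n : (0 < a)%N -> (0 < b)%N ->
  (2 ^ (a + b - 1) * n = 2 ^ (a - 1) * (2 * (2 ^ (b - 1) * n)))%N.
Proof.
by case: a b => [|a] [|b] // _ _; rewrite !mulnA -expnSr -expnD; congr (2 ^ _ * _)%N; lia.
Qed.

Lemma eta_pow2_mod (m k mu : nat) (c : int) : (1 <= k <= 3)%N -> is_mu m k mu ->
  (c = A k (2 * mu - 1) %[mod m%:Z])%Z ->
  forall alpha n : nat, (1 <= alpha)%N ->
  (eta_coef k (2 ^ (2 * mu * alpha - 1) * n) = c ^+ alpha * eta2_coef k n %[mod m%:Z])%Z.
Proof.
move=> hk [mu1 mB _] cA.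
have step n : (m%:Z %| eta_coef k (2 ^ (2 * mu - 1) * n) - c * eta2_coef k n)%Z.
  have e : (2 * mu - 1 = 2 * mu.-1 + 1)%N by lia.
  have [b] := eta_pow2 _ n mu.-1 hk; rewrite -e => ->.
  rewrite (_ : _ - _ = (A k (2 * mu - 1) - c) * eta2_coef k n + B k (2 * mu - 1) * b).
    by rewrite rpredD ?dvdz_mulr // -eqz_mod_dvd cA.
  by ring.
move=> [//|alpha] n _; apply/eqP; rewrite eqz_mod_dvd.
elim: alpha => [|alpha IH]; first by rewrite muln1 expr1.
have -> : (2 ^ (2 * mu * alpha.+2 - 1) * n
           = 2 ^ (2 * mu - 1) * (2 * (2 ^ (2 * mu * alpha.+1 - 1) * n)))%N.
  by rewrite mulnS pow2_addB1 // !muln_gt0 mu1.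
have := step (2 * (2 ^ (2 * mu * alpha.+1 - 1) * n))%N.
rewrite eta2_coef_double => h.
(* The error splits into that of one round and c times the error of the earlier rounds. *)
rewrite (_ : _ - _ = (eta_coef k (2 ^ (2 * mu - 1) * (2 * (2 ^ (2 * mu * alpha.+1 - 1) * n)))
    - c * eta_coef k (2 ^ (2 * mu * alpha.+1 - 1) * n))
    + c * (eta_coef k (2 ^ (2 * mu * alpha.+1 - 1) * n) - c ^+ alpha.+1 * eta2_coef k n)).
  by rewrite rpredD // dvdz_mull.
by rewrite [c ^+ alpha.+2]exprS; ring.
Qed.

Theorem theorem1p3 (m k mu : nat) (c1 : int)
    (hm : (2 <= m)%N) (hk : (1 <= k <= 3)%N) (hmu : is_mu m k mu)
    (hc1 : 0 <= c1 <= m%:Z - 1)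
    (hc1A : (c1 = A k (2 * mu - 1) %[mod m%:Z])%Z) :
  ((forall alpha : nat, (1 <= alpha)%N -> ~ (m%:Z %| c1 ^+ alpha)%Z) ->
   forall alpha n : nat, (1 <= alpha)%N ->
     (m%:Z %| pcoef (8 * k)
                (2 ^ (2 * mu * alpha) * n
                 + ((2 * k + 3) * 2 ^ (2 * mu * alpha - 1) - k) %/ 3)%N)%Z)
  /\
  (forall alpha : nat, (1 <= alpha)%N -> (m%:Z %| c1 ^+ alpha)%Z ->
   forall n : nat,
     (m%:Z %| pcoef (8 * k)
                (2 ^ (2 * mu * alpha - 1) * n
                 + (k * (2 ^ (2 * mu * alpha) - 1)) %/ 3)%N)%Z).
Proof.
have [mu1 _ _] := hmu.
have key (alpha n N : nat) : (1 <= alpha)%N ->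
    (m%:Z %| c1 ^+ alpha * eta2_coef k n)%Z ->
    (2 ^ (2 * mu * alpha - 1) * n = 3 * N + k)%N -> (m%:Z %| pcoef (8 * k) N)%Z.
  move=> alpha1 dvd e; rewrite -eta_coefE -e.
  by apply/dvdz_mod0P; rewrite (eta_pow2_mod _ _ _ _ hk hmu hc1A) //; apply/dvdz_mod0P.
have pow2S alpha : (1 <= alpha)%N ->
    (2 ^ (2 * mu * alpha) = 2 * 2 ^ (2 * mu * alpha - 1))%N.
  move=> alpha1; rewrite -expnS; congr (2 ^ _)%N.
  have : (0 < 2 * mu * alpha)%N by rewrite !muln_gt0 mu1.
  by move: (2 * mu * alpha)%N => x; lia.
split=> [_ alpha n alpha1 | alpha alpha1 c1alpha n].
  (* The argument is odd, which kills the [eta2_coef] term, and 2^(e-1) (6 n + 2 k + 3) = 3 * 2^e n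
     + (2 k + 3) 2^(e-1) for e = 2 mu alpha. *)
  apply: (key alpha (6 * n + (2 * k + 3))%N) => //.
    by rewrite eta2_coef_odd ?mulr0 //; lia.
  have ma1 : (1 <= mu * alpha)%N by rewrite muln_gt0 mu1.
  have [le3 /divnK] := dvd3_offset1 k ma1.
  rewrite !mulnA pow2S // in le3 *.
  move: (_ %/ 3)%N => d dE; move: (2 ^ _)%N le3 dE => x le3 dE; lia.
(* Here 2^(e-1) (3 n + 2 k) = 3 * 2^(e-1) n + k (2^e - 1) + k for e = 2 mu alpha. *)
apply: (key alpha (3 * n + 2 * k)%N) => //; first by rewrite dvdz_mulr.
have /divnK := dvd3_offset2 k (mu * alpha).
have x0 : (0 < 2 ^ (2 * mu * alpha - 1))%N by rewrite expn_gt0.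
rewrite !mulnA pow2S // in x0 *.
move: (_ %/ 3)%N => d; move: (2 ^ _)%N x0 => x x0 dE; nia.
Qed.
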